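(* There is a universal constant $c$ such that the following holds. Let $T$ be a decision tree of depth $d$ computing a Boolean function $f:\{-1,1\}^n\to\{0,1\}$, and let $p=\Pr_x[f(x)=1]$ for uniform $x$. Then for every $\ell\le d$, $$\sum_{S\subseteq[n]:|S|=\ell}|\hat f(S)|\ \le\ \sqrt{c^{\ell}\binom{d}{\ell}}\cdot p\cdot\prod_{i=0}^{\ell-1}\sqrt{\log(4n^i/p)}.$$
   Context: Fourier coefficients: $\hat f(S)=\mathbb E_{x}[f(x)\prod_{i\in S}x_i]$ for $x$ uniform on $\{-1,1\}^n$. *)

(* Defs.v *)
From HB Require Import structures.
From mathcomp Require Import all_boot all_order all_algebra.
From mathcomp Require Import reals exp.
Set Implicit Arguments. Unset Strict Implicit. Unset Printing Implicit Defensive.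
Import Order.TTheory GRing.Theory Num.Theory.
Local Open Scope ring_scope.

(* Points of {-1,1}^n are encoded as x : {ffun 'I_n -> bool};
   the coordinate x_i in {-1,1} is [pm (x i)] (true |-> -1, false |-> 1). *)
Definition pm (R : ringType) (b : bool) : R := if b then -1 else 1.

(* Decision trees over n variables with Boolean (0/1) leaves.
   [Node i t_neg t_pos] queries x_i and goes to t_neg if x_i = -1,
   to t_pos if x_i = 1. *)
Inductive dtree (n : nat) : Type :=
| Leaf of bool
| Node of 'I_n & dtree n & dtree n.

Fixpoint dt_eval (n : nat) (t : dtree n) (x : {ffun 'I_n -> bool}) : bool :=
  match t with
  | Leaf b => b
  | Node i t0 t1 => if x i then dt_eval t0 x else dt_eval t1 x
  end.

Fixpoint dt_depth (n : nat) (t : dtree n) : nat :=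
  match t with
  | Leaf _ => 0%N
  | Node _ t0 t1 => (maxn (dt_depth t0) (dt_depth t1)).+1
  end.

Definition fval (R : ringType) (n : nat) (f : {ffun 'I_n -> bool} -> bool)
  (x : {ffun 'I_n -> bool}) : R := (f x)%:R.

Definition fourier (R : fieldType) (n : nat) (f : {ffun 'I_n -> bool} -> bool)
  (S : {set 'I_n}) : R :=
  (2 ^+ n)^-1 * \sum_(x : {ffun 'I_n -> bool})
                  fval R f x * \prod_(i in S) pm R (x i).

Definition prob1 (R : fieldType) (n : nat) (f : {ffun 'I_n -> bool} -> bool) : R :=
  (2 ^+ n)^-1 * \sum_(x : {ffun 'I_n -> bool}) fval R f x.

(* Main.v *)
Require Import Defs.
From mathcomp Require Import all_boot all_order all_algebra.
From mathcomp Require Import reals exp.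
From mathcomp Require boolp.
From mathcomp Require Import ring lra.
Set Implicit Arguments. Unset Strict Implicit. Unset Printing Implicit Defensive.
Import Order.TTheory GRing.Theory Num.Theory.
Local Open Scope ring_scope.

(** Write p for the probability that f = 1, and let V_t(x) be the set of
    variables queried in the first t steps on input x.  Signs a_S turn the
    left-hand side into E[f(x) X_d(x)], where X_t is the sum of a_S x_S over the
    S of size l inside V_t(x): the other S cancel by flipping an unqueried
    variable of S.  As a process in t, X is a martingale whose increments are
    x_i Y, with x_i the fresh variable and Y the process of level l - 1 for the
    signs a_(S u i).  The two-point inequality
    E|a + eps b|^(2k) <= (a^2 + 2 k b^2)^k and Minkowski's inequality in L^k
    give |X_(t+1)|_(2k)^2 <= |X_t|_(2k)^2 + 2 k |Y|_(2k)^2.  Since i depends on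
    x, |Y|_(2k) is bounded by summing the 2k'-th moments over all n choices of
    i, for some k' >= k with n <= 2^k'; this is why the moments grow with the
    level, k_i ~ log(4 n^i / p).  Pascal's rule then yields
    |X_d|_(2 k_0)^2 <= 4^l C(d, l) k_0 ... k_(l-1), and Young's inequality
    yields E[f X] <= 2 p |X|_(2 k_0) because 2^(2 k_0) >= 1 / p. *)

Lemma leq_bin_double k j : ('C(2 * k, 2 * j) <= 'C(k, j) * (2 * k) ^ j)%N.
Proof.
elim: j => [|j IH]; first by rewrite muln0 !bin0.
have [kj|_] := leqP k j; first by rewrite bin_small // ltn_pmul2l.
have bin_doubleS : (j.+1 * (2 * j).+1 * 'C(2 * k, 2 * j.+1)
                    = (k - j) * (2 * k - (2 * j).+1) * 'C(2 * k, 2 * j))%N.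
  have := mul_bin_left (2 * k) (2 * j); rewrite -mulnBr => binS_even.
  have := mul_bin_left (2 * k) (2 * j).+1.
  rewrite -[(2 * j).+2]/(2 + 2 * j)%N -mulnS => binS_odd.
  apply/eqP; rewrite -(eqn_pmul2l (isT : (0 < 2)%N)).
  have -> : (2 * (j.+1 * (2 * j).+1 * 'C(2 * k, 2 * j.+1))
             = (2 * j).+1 * (2 * j.+1 * 'C(2 * k, 2 * j.+1)))%N by ring.
  by rewrite binS_odd mulnCA binS_even; apply/eqP; ring.
rewrite -(@leq_pmul2l (j.+1 * (2 * j).+1)) // bin_doubleS mulnACA.
rewrite mul_bin_left -!mulnA leq_mul2l; apply/orP; right.
apply: leq_trans (leq_mul (leq_subr _ _) IH) _.
by rewrite mulnCA -expnS leq_mul2l leq_pmull ?orbT.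
Qed.

Lemma sum_ord_even (V : nmodType) (F : nat -> V) k :
  (forall j, F (2 * j).+1 = 0) ->
  \sum_(i < (2 * k).+1) F i = \sum_(j < k.+1) F (2 * j)%N.
Proof.
move=> F_odd; elim: k => [|k IH]; first by rewrite !big_ord1.
by rewrite [RHS]big_ord_recr -IH mulnS !big_ord_recr /= F_odd addr0.
Qed.

(* The odd terms of the two binomial expansions cancel, and the even ones are
   compared one by one. *)
Lemma two_point_moment_le (R : realDomainType) (a b : R) k :
  (a + b) ^+ (2 * k) + (a - b) ^+ (2 * k)
  <= 2 * (a ^+ 2 + (2 * k)%:R * b ^+ 2) ^+ k.
Proof.
rewrite exprDn exprBn -big_split /=.
pose F i := a ^+ (2 * k - i) * b ^+ i *+ 'C(2 * k, i)
  + (-1) ^+ i * a ^+ (2 * k - i) * b ^+ i *+ 'C(2 * k, i).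
rewrite (@sum_ord_even _ F) => [|j]; last first.
  by rewrite /F -signr_odd /= oddM /= expr1 mulN1r mulNr mulNrn subrr.
rewrite exprDn mulr_sumr; apply: ler_sum => j _.
rewrite /F -signr_odd oddM /= expr0 mul1r -mulnBr !exprM -[leLHS]mulr2n.
rewrite -[leLHS]mulr_natl ler_pM2l //.
rewrite [(_%:R * _) ^+ _]exprMn -natrX mulr_natl mulrnAr -mulrnA.
apply: ler_wpMn2l; last by rewrite [leqRHS]mulnC leq_bin_double.
by apply: mulr_ge0; apply: exprn_ge0; apply: sqr_ge0.
Qed.

Lemma subr_mul_expr_ge0 (R : realDomainType) (u v : R) k : 0 <= u -> 0 <= v ->
  0 <= (u - v) * (u ^+ k - v ^+ k).
Proof.
move=> u0 v0; case/orP: (le_total u v) => uv.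
  by rewrite mulr_le0 ?subr_le0 ?lerXn2r.
by rewrite mulr_ge0 ?subr_ge0 ?lerXn2r.
Qed.

Lemma young_expr (R : realDomainType) (x y : R) k : 0 <= x -> 0 <= y ->
  k.+1%:R * y ^+ k * x <= x ^+ k.+1 + k%:R * y ^+ k.+1.
Proof.
move=> x0 y0; elim: k => [|k IH].
  by rewrite expr0 !mul1r expr1 mul0r addr0.
have yIH := ler_wpM2l y0 IH; have := subr_mul_expr_ge0 k.+1 x0 y0.
by rewrite !exprS -!(natr1 k.+1) in yIH *; lra.
Qed.

Lemma radon_expr (R : realFieldType) (a b x y : R) k :
  0 < a -> 0 < b -> 0 <= x -> 0 <= y ->
  (x + y) ^+ k.+1 / (a + b) ^+ k <= x ^+ k.+1 / a ^+ k + y ^+ k.+1 / b ^+ k.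
Proof.
move=> a0 b0 x0 y0; have ab0 : 0 < a + b by rewrite addr_gt0.
have [c c0 cE] : exists2 c, 0 <= c & x + y = c * (a + b).
  exists ((x + y) / (a + b)); first by rewrite divr_ge0 ?addr_ge0 // ltW.
  by rewrite divfK ?lt0r_neq0.
have tangent (u v : R) : 0 < u -> 0 <= v ->
    k.+1%:R * c ^+ k * v <= v ^+ k.+1 / u ^+ k + k%:R * c ^+ k.+1 * u.
  move=> u0 v0; have w0 : 0 <= v / u by rewrite divr_ge0 // ltW.
  have := ler_wpM2r (ltW u0) (young_expr k w0 c0).
  rewrite /= -[_ * u]mulrA divfK ?lt0r_neq0 // mulrDl expr_div_n.
  by rewrite [u ^+ k.+1]exprSr invfM [_ ^+ _ * _]mulrA divfK ?lt0r_neq0.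
have := lerD (tangent _ _ a0 x0) (tangent _ _ b0 y0).
rewrite -mulrDr addrACA -mulrDr cE exprMn [(a + b) ^+ k.+1]exprS !mulrA.
by rewrite mulfK ?expf_neq0 ?lt0r_neq0 // !exprS -natr1; lra.
Qed.

Section Mean.
Variables (R : realFieldType) (T : finType).
Implicit Types (g h : T -> R) (b c : R) (k m : nat).

Definition mean g : R := #|T|%:R^-1 * \sum_x g x.

Lemma eq_mean g h : g =1 h -> mean g = mean h.
Proof. by move=> gh; rewrite /mean (eq_bigr _ (fun x _ => gh x)). Qed.

Lemma meanD g h : mean (fun x => g x + h x) = mean g + mean h.
Proof. by rewrite /mean big_split mulrDr. Qed.

Lemma meanZ c g : mean (fun x => c * g x) = c * mean g.
Proof. by rewrite /mean -mulr_sumr mulrCA. Qed.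

Lemma mean_sum (I : finType) (P : pred I) (g : I -> T -> R) :
  mean (fun x => \sum_(i | P i) g i x) = \sum_(i | P i) mean (g i).
Proof. by rewrite /mean exchange_big mulr_sumr. Qed.

Lemma mean_comp_inj (s : T -> T) g : injective s -> mean (g \o s) = mean g.
Proof. by move=> s_inj; rewrite /mean [in RHS](reindex_inj s_inj). Qed.

Lemma ler_mean g h : (forall x, g x <= h x) -> mean g <= mean h.
Proof. by move=> gh; rewrite ler_wpM2l ?invr_ge0 // ler_sum. Qed.

Lemma mean_ge0 g : (forall x, 0 <= g x) -> 0 <= mean g.
Proof. by move=> g0; rewrite mulr_ge0 ?invr_ge0 ?sumr_ge0. Qed.

Lemma mean_le_cst g c : 0 <= c -> (forall x, g x <= c) -> mean g <= c.
Proof.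
move=> c0 /ler_mean/le_trans; apply.
rewrite /mean sumr_const -[c *+ _]mulr_natl mulrA.
have [->|T0] := eqVneq #|T| 0%N; first by rewrite mulr0 mul0r.
by rewrite mulVf ?mul1r // pnatr_eq0.
Qed.

Lemma ler_norm_mean g : `|mean g| <= mean (fun x => `|g x|).
Proof.
rewrite normrM ger0_norm ?invr_ge0 // ler_wpM2l ?invr_ge0 //.
exact: ler_norm_sum.
Qed.

Lemma mean_le0_eq0 g : (forall x, 0 <= g x) -> mean g <= 0 -> forall x, g x = 0.
Proof.
move=> g0 mg x; apply/eqP; rewrite eq_le g0 andbT.
have T0 : 0 < #|T|%:R :> R by rewrite ltr0n (cardD1 x).
move: mg; rewrite /mean pmulr_rle0 ?invr_gt0 //; apply: le_trans.
by rewrite (bigD1 x) //= lerDl sumr_ge0.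
Qed.

(* For nonnegative [g] and [b], the L^k norm of [g] is at most [b]; stated
   without roots. *)
Definition Lnorm_le k g b := mean (fun x => g x ^+ k) <= b ^+ k.

Lemma Lnorm_le0_eq0 k g : (0 < k)%N -> (forall x, 0 <= g x) ->
  Lnorm_le k g 0 -> forall x, g x = 0.
Proof.
move=> k0 g0; rewrite /Lnorm_le expr0n gtn_eqF // => mg x.
have /eqP := mean_le0_eq0 (fun y => exprn_ge0 k (g0 y)) mg x.
by rewrite expf_eq0 k0 => /eqP.
Qed.

Lemma Lnorm_le_cst k g b :
  (forall x, 0 <= g x <= b) -> 0 <= b -> Lnorm_le k g b.
Proof.
move=> gb b0; apply: mean_le_cst => [|x]; first exact: exprn_ge0.
by have /andP[g0 gxb] := gb x; rewrite lerXn2r.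
Qed.

Lemma ler_Lnorm_le k g h b : (forall x, 0 <= g x <= h x) ->
  Lnorm_le k h b -> Lnorm_le k g b.
Proof.
move=> gh; apply: le_trans; apply: ler_mean => x.
by have /andP[g0 gxh] := gh x; rewrite lerXn2r // nnegrE (le_trans g0).
Qed.

Lemma Lnorm_leZ k c g b : 0 <= c -> Lnorm_le k g b ->
  Lnorm_le k (fun x => c * g x) (c * b).
Proof.
move=> c0 gb; rewrite /Lnorm_le (eq_mean (fun x => exprMn k c (g x))) meanZ.
by rewrite exprMn ler_wpM2l ?exprn_ge0.
Qed.

Lemma minkowski_Lnorm_le k g h a b : (0 < k)%N -> 0 <= a -> 0 <= b ->
  (forall x, 0 <= g x) -> (forall x, 0 <= h x) ->
  Lnorm_le k g a -> Lnorm_le k h b -> Lnorm_le k (fun x => g x + h x) (a + b).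
Proof.
move=> k0 a0 b0 g0 h0 ga hb.
have [a_eq0|an0] := eqVneq a 0.
  rewrite a_eq0 add0r in ga *; apply: ler_Lnorm_le hb => x.
  by rewrite (Lnorm_le0_eq0 k0 g0 ga) add0r h0 lexx.
have [b_eq0|bn0] := eqVneq b 0.
  rewrite b_eq0 addr0 in hb *; apply: ler_Lnorm_le ga => x.
  by rewrite (Lnorm_le0_eq0 k0 h0 hb) addr0 g0 lexx.
have {an0}ap : 0 < a by rewrite lt_def an0.
have {bn0}bp : 0 < b by rewrite lt_def bn0.
have abp : 0 < a + b by rewrite addr_gt0.
case: k k0 ga hb => // k _ ga hb.
pose bound x :=
  (a + b) ^+ k * ((a ^+ k)^-1 * g x ^+ k.+1 + (b ^+ k)^-1 * h x ^+ k.+1).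
apply: (@le_trans _ _ (mean bound)).
  apply: ler_mean => x; rewrite /bound -ler_pdivrMl ?exprn_gt0 //.
  by rewrite ![_^-1 * _]mulrC radon_expr.
rewrite meanZ meanD !meanZ exprSr ler_pM2l ?exprn_gt0 //.
by rewrite lerD // ler_pdivrMl ?exprn_gt0 // -exprSr.
Qed.

Lemma Lnorm_le_pred k g b : 0 <= b -> (forall x, 0 <= g x) ->
  Lnorm_le k.+2 g b -> Lnorm_le k.+1 g b.
Proof.
move=> b0 g0 gb; have [b_eq0|bn0] := eqVneq b 0.
  rewrite b_eq0 in gb *; apply: Lnorm_le_cst => // x.
  by rewrite (Lnorm_le0_eq0 _ g0 gb) ?lexx.
have bp : 0 < b by rewrite lt_def bn0.
have k2_gt0 : 0 < k.+2%:R :> R by rewrite ltr0n.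
rewrite /Lnorm_le -(ler_pM2l (mulr_gt0 k2_gt0 bp)) -meanZ -mulrA -exprS.
pose young x := b ^+ k.+2 + k.+1%:R * g x ^+ k.+2.
apply: (@le_trans _ _ (mean young)).
  by apply: ler_mean => x; rewrite mulrAC young_expr.
rewrite meanD meanZ -(natr1 k.+1) mulrDl mul1r addrC lerD //; last first.
  by apply: mean_le_cst; rewrite ?exprn_ge0.
by rewrite ler_pM2l.
Qed.

Lemma leq_Lnorm_le k m g b : (0 < k <= m)%N -> 0 <= b -> (forall x, 0 <= g x) ->
  Lnorm_le m g b -> Lnorm_le k g b.
Proof.
move=> /andP[k0 km] b0 g0; rewrite -(subnKC km); elim: (m - k)%N => [|d IH].
  by rewrite addn0.
rewrite addnS => gb; apply: IH; rewrite -(prednK k0) addSn in gb *.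
exact: Lnorm_le_pred.
Qed.

Lemma Lnorm_le_select (I : finType) (s : T -> option I) (g : I -> T -> R) m b :
  (0 < m)%N -> 0 <= b -> (#|I| <= 2 ^ m)%N -> (forall i x, 0 <= g i x) ->
  (forall i, Lnorm_le m (g i) b) ->
  Lnorm_le m (fun x => oapp (g^~ x) 0 (s x)) (2 * b).
Proof.
move=> m0 b0 Im g0 gb.
apply: (@le_trans _ _ (mean (fun x => \sum_i g i x ^+ m))).
  apply: ler_mean => x; case: (s x) => [i|] /=.
    by rewrite (bigD1 i) //= lerDl sumr_ge0 // => j _; rewrite exprn_ge0.
  by rewrite expr0n gtn_eqF // sumr_ge0 // => j _; rewrite exprn_ge0.
rewrite mean_sum; apply: le_trans (ler_sum _ (fun i _ => gb i)) _.
rewrite sumr_const -[leLHS]mulr_natl exprMn ler_wpM2r ?exprn_ge0 //.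
by rewrite -natrX ler_nat.
Qed.

(* Young's inequality compares [g x] with the threshold [2 * b]. *)
Lemma mean_mul_le m g h b : (0 < m)%N -> 0 < b ->
  (forall x, 0 <= g x) -> (forall x, 0 <= h x <= 1) ->
  Lnorm_le m g b -> 1 <= mean h * 2 ^+ m ->
  mean (fun x => h x * g x) <= 2 * b * mean h.
Proof.
case: m => // m _ bp g0 h01 gb h_large; have c0 : 0 < 2 * b by rewrite mulr_gt0.
have cm0 : 0 < m.+1%:R * (2 * b) ^+ m by rewrite mulr_gt0 ?exprn_gt0.
rewrite -(ler_pM2l cm0) -[leLHS]meanZ.
pose young x := g x ^+ m.+1 + m%:R * (2 * b) ^+ m.+1 * h x.
apply: (@le_trans _ _ (mean young)).
  apply: ler_mean => x; have /andP[h0 h1] := h01 x.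
  have := ler_wpM2l h0 (young_expr m (g0 x) (ltW c0)).
  rewrite mulrDr mulrCA [h x * (_ * _)]mulrC => /le_trans; apply.
  by rewrite lerD2r ler_piMl ?exprn_ge0.
have -> : m.+1%:R * (2 * b) ^+ m * (2 * b * mean h)
    = (2 * b) ^+ m.+1 * mean h + m%:R * (2 * b) ^+ m.+1 * mean h.
  by rewrite exprS -natr1; ring.
rewrite meanD meanZ lerD2r; apply: (le_trans gb).
by rewrite exprMn -mulrA mulrCA ler_peMr ?exprn_ge0 ?(ltW bp) // mulrC.
Qed.

End Mean.

Local Notation cube n := {ffun 'I_n -> bool}.

Section Characters.
Variable (n : nat).
Implicit Types (x : cube n) (i j : 'I_n) (S : {set 'I_n}) (o : option 'I_n).

Definition flip o x : cube n := [ffun j => (Some j == o) (+) x j].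

Lemma flip_none x : flip None x = x.
Proof. by apply/ffunP => j; rewrite ffunE. Qed.

Lemma flipK o : involutive (flip o).
Proof. by move=> x; apply/ffunP => j; rewrite !ffunE addbA addbb. Qed.

Lemma flip_out i j x : j != i -> flip (Some i) x j = x j.
Proof. by rewrite ffunE (inj_eq Some_inj) => /negbTE ->. Qed.

Lemma mean_flip_select (R : realFieldType) (g : cube n -> R)
    (s : cube n -> option 'I_n) : (forall x, s (flip (s x) x) = s x) ->
  mean (fun x => g (flip (s x) x)) = mean g.
Proof.
move=> s_flip; apply: (@mean_comp_inj _ _ (fun x => flip (s x) x)).
by apply: inv_inj => x; rewrite s_flip flipK.
Qed.

Definition chi (R : nzRingType) S x : R := \prod_(i in S) pm R (x i).

Lemma pm_sqr (R : nzRingType) b : pm R b ^+ 2 = 1.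
Proof. by case: b; rewrite /pm ?sqrrN expr1n. Qed.

Lemma pm_flip (R : nzRingType) i x : pm R (flip (Some i) x i) = - pm R (x i).
Proof. by rewrite ffunE eqxx /pm; case: (x i); rewrite ?opprK. Qed.

Lemma normr_chi (R : numDomainType) S x : `|chi R S x| = 1.
Proof.
rewrite normr_prod big1 // => i _.
by rewrite /pm; case: (x i); rewrite ?normrN1 ?normr1.
Qed.

Lemma chi0 (R : nzRingType) x : chi R set0 x = 1.
Proof. by rewrite /chi big_set0. Qed.

Lemma chiU1 (R : comNzRingType) S i x :
  i \notin S -> chi R (i |: S) x = pm R (x i) * chi R S x.
Proof. by move=> iS; rewrite /chi big_setU1. Qed.

Lemma chi_flip_out (R : nzRingType) S i x :
  i \notin S -> chi R S (flip (Some i) x) = chi R S x.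
Proof.
move=> iS; apply: eq_bigr => j jS; rewrite flip_out //.
by apply: contraNneq iS => <-.
Qed.

Lemma chi_flip_in (R : comNzRingType) S i x :
  i \in S -> chi R S (flip (Some i) x) = - chi R S x.
Proof.
move=> iS; rewrite -(setD1K iS) !chiU1 ?setD11 // pm_flip mulNr.
by rewrite chi_flip_out ?setD11.
Qed.

End Characters.

Section FourierMean.
Variables (R : realFieldType) (n : nat) (f : cube n -> bool).

Lemma card_cube : #|{: cube n}|%:R = 2 ^+ n :> R.
Proof. by rewrite card_ffun card_bool card_ord natrX. Qed.

Lemma fourierE S : fourier R f S = mean (fun x => fval R f x * chi R S x).
Proof. by rewrite /mean card_cube. Qed.

Lemma prob1E : prob1 R f = mean (fval R f).
Proof. by rewrite /mean card_cube. Qed.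

Lemma fval_itv01 x : 0 <= fval R f x <= 1.
Proof. by rewrite /fval; case: (f x); rewrite lexx ler01. Qed.

Lemma prob1_ge0 : 0 <= prob1 R f.
Proof. by rewrite prob1E mean_ge0 // => x; have /andP[] := fval_itv01 x. Qed.

Lemma prob1_le1 : prob1 R f <= 1.
Proof. by rewrite prob1E mean_le_cst // => x; have /andP[] := fval_itv01 x. Qed.

Lemma normr_fourier_le S : `|fourier R f S| <= prob1 R f.
Proof.
rewrite fourierE prob1E; apply: le_trans (ler_norm_mean _) _.
apply: ler_mean => x.
by rewrite normrM normr_chi mulr1 ger0_norm //; have /andP[] := fval_itv01 x.
Qed.

End FourierMean.

Section Exploration.
Variable (n : nat).
Implicit Types (T : dtree n) (t : nat) (x y : cube n) (i : 'I_n).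

Definition root_query T : option 'I_n :=
  if T is Node i _ _ then Some i else None.

Definition dt_step x T : dtree n :=
  if T is Node i t0 t1 then if x i then t0 else t1 else T.

Definition residual T t x : dtree n := iter t (dt_step x) T.

Fixpoint queried T t x : {set 'I_n} :=
  if t is t'.+1 then
    if root_query (residual T t' x) is Some i then i |: queried T t' x
    else queried T t' x
  else set0.

(* A repeated query reveals nothing and is treated like no query. *)
Definition next_query T t x : option 'I_n :=
  if root_query (residual T t x) is Some i then
    if i \in queried T t x then None else Some i
  else None.

Lemma next_query_fresh T t x i :
  next_query T t x = Some i -> i \notin queried T t x.
Proof.
rewrite /next_query; case: root_query => // j.
by case: ifP => // /negbT jq [<-].
Qed.

Lemma queriedS T t x :
  queried T t.+1 x =
    if next_query T t x is Some i then i |: queried T t x else queried T t x.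
Proof.
rewrite /= /next_query; case: root_query => // i.
by case: ifP => // iq; apply/setUidPr; rewrite sub1set.
Qed.

Lemma eq_in_queried T t x y : {in queried T t x, x =1 y} ->
  residual T t y = residual T t x /\ queried T t y = queried T t x.
Proof.
elim: t => //= t IH; case root: (residual T t x) => [b|i t0 t1] /= xy.
  by have [-> ->] := IH xy; rewrite root.
have [|-> ->] := IH; first by move=> j jq; apply: xy; rewrite setU1r.
by rewrite root /= -xy ?setU11.
Qed.

Lemma flip_unqueried T t x i : i \notin queried T t x ->
  residual T t (flip (Some i) x) = residual T t x /\
  queried T t (flip (Some i) x) = queried T t x.
Proof.
move=> iq; apply: eq_in_queried => j jq; rewrite flip_out //.
by apply: contraNneq iq => <-.
Qed.

Lemma next_query_flip T t x :
  next_query T t (flip (next_query T t x) x) = next_query T t x.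
Proof.
case query: (next_query T t x) => [i|]; last by rewrite flip_none.
have [res_flip queried_flip] := flip_unqueried (next_query_fresh query).
by rewrite -[RHS]query /next_query res_flip queried_flip.
Qed.

Lemma dt_depth_gt0 T : (0 < dt_depth T)%N -> (0 < n)%N.
Proof. by case: T => // i *; apply: leq_ltn_trans (ltn_ord i). Qed.

Lemma depth_residual T t x : (dt_depth (residual T t x) <= dt_depth T - t)%N.
Proof.
elim: t => [|t IH] /=; first by rewrite subn0.
rewrite subnS; case: residual IH => //= i t0 t1 lt_depth.
have : (maxn (dt_depth t0) (dt_depth t1) <= (dt_depth T - t).-1)%N.
  by rewrite -ltnS (ltn_predK lt_depth).
by rewrite geq_max => /andP[? ?]; case: ifP.
Qed.

Lemma eval_residual T t x : dt_eval (residual T t x) x = dt_eval T x.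
Proof. by elim: t => //= t <-; case: residual => //= i t0 t1; case: (x i). Qed.

Lemma dt_eval_flip T x i : i \notin queried T (dt_depth T) x ->
  dt_eval T (flip (Some i) x) = dt_eval T x.
Proof.
move=> /flip_unqueried[res_flip _].
rewrite -(eval_residual T (dt_depth T)) res_flip.
rewrite -[RHS](eval_residual T (dt_depth T)).
by have := depth_residual T (dt_depth T) x; rewrite subnn; case: residual.
Qed.

End Exploration.

Lemma sum_subsetU1 (V : nmodType) (I : finType) (A : {set I}) i l
    (F : {set I} -> V) : i \notin A ->
  \sum_(S : {set I} | (S \subset i |: A) && (#|S| == l.+1)) F S
  = \sum_(S : {set I} | (S \subset A) && (#|S| == l.+1)) F S
    + \sum_(S : {set I} | (S \subset A) && (#|S| == l)) F (i |: S).
Proof.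
move=> iA.
have subA (S : {set I}) : (S \subset i |: A) && (i \notin S) = (S \subset A).
  by rewrite -subsetD1 setU1K.
rewrite (bigID (fun S : {set I} => i \notin S)) /=; congr (_ + _).
  by apply: eq_bigl => S; rewrite andbAC subA.
rewrite (reindex_onto (fun S => i |: S) (fun S => S :\ i)) /= => [|S /andP[_]].
  apply: eq_bigl => S; rewrite setU11 andbT -subA subUset sub1set setU11 /=.
  case: (boolP (i \in S)) => iS; last first.
    by rewrite setU1K // eqxx cardsU1 iS !andbT.
  by rewrite andbF; apply/negP => /andP[_ /eqP/setP/(_ i)]; rewrite setD11 iS.
by rewrite negbK => /setD1K.
Qed.

Section LevelMartingale.
Variables (R : realFieldType) (n : nat) (T : dtree n).
Implicit Types (a : {set 'I_n} -> R) (l t : nat) (x : cube n) (i : 'I_n).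

Definition level_sum a l t x : R :=
  \sum_(S : {set 'I_n} | (S \subset queried T t x) && (#|S| == l))
    a S * chi R S x.

Definition link a i (S : {set 'I_n}) : R := a (i |: S).

Definition level_incr a l t x : R :=
  if next_query T t x is Some i then pm R (x i) * level_sum (link a i) l t x
  else 0.

Lemma level_sum0 a t x : level_sum a 0 t x = a set0.
Proof.
rewrite /level_sum (big_pred1 set0) ?chi0 ?mulr1 // => S /=.
by rewrite cards_eq0 andb_idl // => /eqP ->; apply: sub0set.
Qed.

Lemma level_sum_unqueried a l x : level_sum a l.+1 0 x = 0.
Proof.
rewrite /level_sum big_pred0 // => S /=; rewrite subset0.
by case: eqP => // ->; rewrite cards0.
Qed.

Lemma level_sumS a l t x :
  level_sum a l.+1 t.+1 x = level_sum a l.+1 t x + level_incr a l t x.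
Proof.
rewrite /level_incr /level_sum queriedS.
case query: next_query => [i|]; last by rewrite addr0.
have iq := next_query_fresh query.
rewrite sum_subsetU1 // mulr_sumr; congr (_ + _).
apply: eq_bigr => S /andP[Sq _]; rewrite chiU1 1?mulrCA //.
by apply: contra iq; apply: (subsetP Sq).
Qed.

Lemma level_sum_flip a l t x i :
  i \notin queried T t x ->
  level_sum a l t (flip (Some i) x) = level_sum a l t x.
Proof.
move=> iq; rewrite /level_sum (flip_unqueried iq).2.
apply: eq_bigr => S /andP[Sq _]; rewrite chi_flip_out //.
by apply: contra iq; apply: (subsetP Sq).
Qed.

Lemma level_sumS_flip a l t x :
  level_sum a l.+1 t.+1 (flip (next_query T t x) x)
  = level_sum a l.+1 t x - level_incr a l t x.
Proof.
rewrite level_sumS /level_incr next_query_flip.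
case query: (next_query T t x) => [i|]; last by rewrite flip_none subr0 addr0.
have iq := next_query_fresh query.
by rewrite !level_sum_flip // pm_flip mulNr.
Qed.

Lemma level_incr_sqr a l t x :
  level_incr a l t x ^+ 2
  = oapp (fun i => level_sum (link a i) l t x ^+ 2) 0 (next_query T t x).
Proof.
rewrite /level_incr; case: next_query => [i|] /=; last by rewrite expr0n.
by rewrite exprMn pm_sqr mul1r.
Qed.

Lemma Lnorm_le_level_sumS a l t k b :
  Lnorm_le k (fun x => level_sum a l.+1 t x ^+ 2
                       + (2 * k)%:R * level_incr a l t x ^+ 2) b ->
  Lnorm_le k (fun x => level_sum a l.+1 t.+1 x ^+ 2) b.
Proof.
apply: le_trans; set g := fun x => _ ^+ k.
rewrite -(ler_pM2l (ltr0Sn R 1)) mulr_natl mulr2n.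
rewrite -{2}(mean_flip_select g (next_query_flip T t)) -meanD -meanZ.
apply: ler_mean => x; rewrite /g -!exprM level_sumS level_sumS_flip.
exact: two_point_moment_le.
Qed.

(* The union bound over the [n] possible fresh variables costs the factor
   [n `^ (1 / m) <= 2]. *)
Lemma Lnorm_le_level_incr a l t k m b :
  (0 < k <= m)%N -> (n <= 2 ^ m)%N -> 0 <= b ->
  (forall i, Lnorm_le m (fun x => level_sum (link a i) l t x ^+ 2) b) ->
  Lnorm_le k (fun x => level_incr a l t x ^+ 2) (2 * b).
Proof.
move=> km nm b0 linkb; have m0 : (0 < m)%N by case/andP: km; apply: leq_trans.
apply: (leq_Lnorm_le km) => [|x|]; [exact: mulr_ge0 | exact: sqr_ge0 |].
rewrite /Lnorm_le; under eq_mean => x do rewrite level_incr_sqr.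
by apply: Lnorm_le_select => // [|i x]; rewrite ?card_ord ?sqr_ge0.
Qed.

Lemma Lnorm_le_level_sum l : forall (K : nat -> nat) t a,
  (forall j, (0 < K j <= K j.+1)%N) -> (forall j, (n <= 2 ^ K j.+1)%N) ->
  (forall S, `|a S| <= 1) ->
  Lnorm_le (K 0%N) (fun x => level_sum a l t x ^+ 2)
    (4 ^+ l * (\prod_(j < l) (K j)%:R) * 'C(t, l)%:R).
Proof.
elim: l => [|l IHl] K t a K_mono n_le_exp2K a_le1.
  rewrite big_ord0 expr0 bin0 !mulr1; apply: Lnorm_le_cst => // x.
  by rewrite level_sum0 sqr_ge0 -real_normK ?num_real // exprn_ile1.
have K0_gt0 : (0 < K 0)%N by have /andP[] := K_mono 0%N.
set coef := 4 ^+ l.+1 * _.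
have coef_ge0 : 0 <= coef by rewrite mulr_ge0 ?exprn_ge0 ?prodr_ge0.
elim: t => [|t IHt].
  rewrite bin0n mulr0; apply: Lnorm_le_cst => // x.
  by rewrite level_sum_unqueried expr0n lexx.
pose link_bound : R := 4 ^+ l * (\prod_(j < l) (K j.+1)%:R) * 'C(t, l)%:R.
have link_bound_ge0 : 0 <= link_bound.
  by rewrite !mulr_ge0 ?exprn_ge0 ?prodr_ge0.
have -> : coef * 'C(t.+1, l.+1)%:R
    = coef * 'C(t, l.+1)%:R + (2 * K 0%N)%:R * (2 * link_bound).
  rewrite binS natrD mulrDr; congr (_ + _).
  by rewrite /coef /link_bound big_ord_recl exprS natrM; ring.
apply: Lnorm_le_level_sumS; apply: minkowski_Lnorm_le => //.
- by rewrite mulr_ge0.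
- by apply: mulr_ge0 => //; apply: mulr_ge0.
- by move=> x; apply: sqr_ge0.
- by move=> x; rewrite mulr_ge0 ?sqr_ge0.
apply: Lnorm_leZ => //; apply: (Lnorm_le_level_incr (K_mono 0%N)) => // i.
by apply: (IHl (fun j => K j.+1)) => // S; apply: a_le1.
Qed.

End LevelMartingale.

Section LevelFourier.
Variables (R : realFieldType) (n : nat) (T : dtree n).
Let d := dt_depth T.

(* Flipping an unqueried variable of [S] negates [chi S] and preserves the
   output of the tree. *)
Lemma mean_eval_chi_unqueried (S : {set 'I_n}) :
  mean (fun x => fval R (dt_eval T) x *
                 if S \subset queried T d x then 0 else chi R S x) = 0.
Proof.
set g := fun x => _; pose o x := [pick i in S :\: queried T d x].
have o_unqueried x i : o x = Some i -> (i \in S) && (i \notin queried T d x).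
  by rewrite /o; case: pickP => // j; rewrite inE andbC => jS [<-].
have o_flip x : o (flip (o x) x) = o x.
  case ox: (o x) => [i|]; last by rewrite flip_none.
  have /andP[_ /flip_unqueried[_ queried_flip]] := o_unqueried _ _ ox.
  by rewrite -[RHS]ox /o queried_flip.
suff : mean g = - mean g by lra.
rewrite -{1}(mean_flip_select g o_flip) -mulN1r -meanZ; apply: eq_mean => x.
case ox: (o x) => [i|].
  have /andP[iS iq] := o_unqueried _ _ ox.
  rewrite /g /fval dt_eval_flip // (flip_unqueried iq).2 chi_flip_in //.
  by case: ifP => _; ring.
rewrite flip_none /g ifT ?mulr0 //; apply/subsetP => i iS.
apply/negPn/negP => iq.
by move: ox; rewrite /o; case: pickP => // /(_ i); rewrite inE iS iq.
Qed.

Lemma fourier_eval_queried (S : {set 'I_n}) :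
  fourier R (dt_eval T) S
  = mean (fun x => fval R (dt_eval T) x *
                   if S \subset queried T d x then chi R S x else 0).
Proof.
rewrite fourierE -[RHS]addr0 -[X in _ + X](mean_eval_chi_unqueried S) -meanD.
by apply: eq_mean => x; case: ifP => _; rewrite mulr0 ?addr0 ?add0r.
Qed.

Lemma sum_norm_fourier_eval l :
  \sum_(S : {set 'I_n} | #|S| == l) `|fourier R (dt_eval T) S|
  = mean (fun x => fval R (dt_eval T) x *
      level_sum T (fun S => Num.sg (fourier R (dt_eval T) S)) l d x).
Proof.
under eq_bigr => S _ do rewrite normrEsg {2}fourier_eval_queried -meanZ.
rewrite -mean_sum; apply: eq_mean => x.
rewrite /level_sum mulr_sumr; under [RHS]eq_bigl do rewrite andbC.
rewrite big_mkcondr /=; apply: eq_bigr => S _.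
by case: ifP => _; rewrite ?mulr0 // mulrCA.
Qed.

End LevelFourier.

Lemma sum_norm_fourier_eval_le (R : rcfType) n (T : dtree n)
    (K : nat -> nat) l :
  (forall i, (0 < K i <= K i.+1)%N) -> (forall i, (n <= 2 ^ K i.+1)%N) ->
  1 <= prob1 R (dt_eval T) * 2 ^+ K 0%N -> (l <= dt_depth T)%N ->
  \sum_(S : {set 'I_n} | #|S| == l) `|fourier R (dt_eval T) S|
  <= 2 * Num.sqrt (4 ^+ l * (\prod_(i < l) (K i)%:R) * 'C(dt_depth T, l)%:R)
     * prob1 R (dt_eval T).
Proof.
move=> K_mono n_le_exp2K pK ld.
set b := 4 ^+ l * _ * _; set p := prob1 R _ in pK *.
have K_gt0 i : (0 < K i)%N by have /andP[] := K_mono i.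
have K0_double : (0 < 2 * K 0%N)%N by rewrite muln_gt0 K_gt0.
have b0 : 0 < b.
  rewrite !mulr_gt0 ?exprn_gt0 ?ltr0n ?bin_gt0 //.
  by apply: prodr_gt0 => i _; rewrite ltr0n.
rewrite sum_norm_fourier_eval; set X := level_sum T _ l _.
have X_le : Lnorm_le (K 0%N) (fun x => X x ^+ 2) b.
  by apply: Lnorm_le_level_sum => // S; rewrite normr_sg lern1; case: eqP.
apply: (@le_trans _ _ (mean (fun x => fval R (dt_eval T) x * `|X x|))).
  apply: ler_mean => x; apply: ler_wpM2l (ler_norm _).
  by have /andP[] := fval_itv01 R (dt_eval T) x.
rewrite /p prob1E; apply: (@mean_mul_le _ _ (2 * K 0%N)) => //.
- by rewrite sqrtr_gt0.
- by move=> x; apply: fval_itv01.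
- rewrite /Lnorm_le exprM sqr_sqrtr ?(ltW b0) //.
  by under eq_mean => x do rewrite exprM real_normK ?num_real //; exact: X_le.
rewrite -prob1E; apply: le_trans pK _.
by rewrite ler_wpM2l ?prob1_ge0 // ler_weXn2l ?ler1n // leq_pmull.
Qed.

Section UpLog2.
Variable R : realType.
Implicit Types M N : R.

Definition up_log2 M : nat := (Num.truncn (ln M / ln 2)).+1.

Lemma ln2_gt0 : 0 < ln 2 :> R.
Proof. by rewrite ln_gt0 // ltr1n. Qed.

Lemma le_exp2_up_log2 M : 0 < M -> M <= 2 ^+ up_log2 M.
Proof.
move=> M0; rewrite -ler_ln ?posrE ?exprn_gt0 // lnXn // -[_ *+ _]mulr_natl.
by rewrite -ler_pdivrMr ?ln2_gt0 // ltW // truncnS_gt.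
Qed.

Lemma leq_up_log2 M N : 0 < M -> M <= N -> (up_log2 M <= up_log2 N)%N.
Proof.
move=> M0 MN; rewrite ltnS le_truncn // ler_pM2r ?invr_gt0 ?ln2_gt0 //.
by rewrite ler_ln ?posrE // (lt_le_trans M0).
Qed.

Lemma up_log2_le M : 2 <= M -> (up_log2 M)%:R <= 2 / ln 2 * ln M.
Proof.
move=> M2; have M0 : 0 < M by apply: lt_le_trans M2.
have lnM : 1 <= ln M / ln 2.
  by rewrite ler_pdivlMr ?ln2_gt0 // mul1r ler_ln ?posrE.
have : (Num.truncn (ln M / ln 2))%:R <= ln M / ln 2.
  by rewrite truncn_le (le_trans ler01).
by rewrite /up_log2 -natr1 mulrAC -mulrA; lra.
Qed.

End UpLog2.

Lemma prod_sqrtr (R : rcfType) (I : finType) (F : I -> R) :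
  (forall i, 0 <= F i) -> \prod_i Num.sqrt (F i) = Num.sqrt (\prod_i F i).
Proof.
move=> F0; elim/big_rec2: _ => [|i y z _ ->]; first by rewrite sqrtr1.
by rewrite sqrtrM.
Qed.

Lemma sqrt_prod_scale_le (R : rcfType) l (b c : R) (K L : 'I_l -> R) :
  (0 < l)%N -> 0 <= b -> 0 < c -> (forall i, 0 <= K i <= c * L i) ->
  2 * Num.sqrt (4 ^+ l * (\prod_i K i) * b)
  <= Num.sqrt ((16 * c) ^+ l * b) * \prod_i Num.sqrt (L i).
Proof.
move=> l0 b0 c0 KL; have L0 i : 0 <= L i.
  by rewrite -(pmulr_rge0 _ c0); have /andP[] := KL i; apply: le_trans.
have K_le : \prod_i K i <= c ^+ l * \prod_i L i.
  have -> : c ^+ l = \prod_(i < l) c by rewrite prodr_const card_ord.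
  by rewrite -big_split /=; apply: ler_prod.
have cb0 : 0 <= (16 * c) ^+ l * b.
  by rewrite mulr_ge0 ?exprn_ge0 ?mulr_ge0 // ltW.
have sqrt4 : 2 = Num.sqrt (4 : R).
  by rewrite (_ : 4 = 2 ^+ 2) ?sqrtr_sqr ?ger0_norm //; ring.
rewrite prod_sqrtr // [X in X * _]sqrt4 -!sqrtrM // ler_wsqrtr //.
rewrite mulrA [leRHS]mulrAC ler_wpM2r // exprMn -mulrA mulrA ler_pM //.
- by rewrite mulr_ge0 ?exprn_ge0.
- by rewrite prodr_ge0 // => i _; have /andP[] := KL i.
have -> : (16 : R) ^+ l = 4 ^+ l * 4 ^+ l.
  by rewrite -exprMn; congr (_ ^+ _); ring.
by rewrite ler_pM2r ?exprn_gt0 // -[leLHS]expr1 ler_weXn2l // ler1n.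
Qed.

Section MomentExponents.
Variables (R : realType) (n : nat) (p : R).
Hypotheses (n_gt0 : (0 < n)%N) (p_gt0 : 0 < p) (p_le1 : p <= 1).
Implicit Types i : nat.

Definition moment_exponent i : nat := up_log2 (4 * n%:R ^+ i / p).

Lemma le4_exponent_arg i : 4 <= 4 * n%:R ^+ i / p.
Proof.
by rewrite ler_pdivlMr // ler_pM2l // (le_trans p_le1) // exprn_ege1 // ler1n.
Qed.

Lemma exponent_arg_gt0 i : 0 < 4 * n%:R ^+ i / p.
Proof. exact: lt_le_trans (le4_exponent_arg i). Qed.

Lemma leq_moment_exponentS i : (moment_exponent i <= moment_exponent i.+1)%N.
Proof.
rewrite leq_up_log2 ?exponent_arg_gt0 // ler_pM2r ?invr_gt0 // ler_pM2l //.
by rewrite ler_weXn2l ?ler1n.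
Qed.

Lemma leq_exp2_moment_exponentS i : (n <= 2 ^ moment_exponent i.+1)%N.
Proof.
rewrite -(ler_nat R) natrX.
apply: le_trans (le_exp2_up_log2 (exponent_arg_gt0 _)).
rewrite exprSr mulrA mulrAC ler_peMl //.
by rewrite (le_trans _ (le4_exponent_arg i)) // ler1n.
Qed.

Lemma mul_exp2_moment_exponent0 : 1 <= p * 2 ^+ moment_exponent 0.
Proof.
rewrite mulrC -ler_pdivrMr //.
apply: le_trans (le_exp2_up_log2 (exponent_arg_gt0 0)).
by rewrite expr0 mulr1 ler_pM2r ?invr_gt0 // ler1n.
Qed.

Lemma moment_exponent_le i :
  (moment_exponent i)%:R <= 2 / ln 2 * ln (4 * n%:R ^+ i / p).
Proof.
by rewrite up_log2_le // (le_trans _ (le4_exponent_arg i)) // ler_nat.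
Qed.

End MomentExponents.

Theorem mainTheorem7 (R : realType) :
  exists c : R,
    forall (n d : nat) (T : dtree n) (f : {ffun 'I_n -> bool} -> bool),
      dt_depth T = d ->
      (forall x, f x = dt_eval T x) ->
      forall l : nat, (l <= d)%N ->
        \sum_(S : {set 'I_n} | #|S| == l) `|fourier R f S|
        <= Num.sqrt (c ^+ l * ('C(d, l))%:R) * prob1 R f
           * \prod_(i < l) Num.sqrt (ln (4 * (n%:R) ^+ i / prob1 R f)).
Proof.
exists (32 / ln 2) => n d T f dT /boolp.funext fT l ld; rewrite {f}fT.
set p := prob1 R (dt_eval T).
have [l0|l_gt0] := posnP l.
  rewrite l0 big_ord0 expr0 bin0 !mulr1 sqrtr1 mul1r (big_pred1 set0).
    exact: normr_fourier_le.
  by move=> S; apply: cards_eq0.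
have [p0|p_neq0] := eqVneq p 0.
  rewrite p0 mulr0 mul0r big1 // => S _; apply/eqP.
  by rewrite -normr_le0 normr_id -p0 normr_fourier_le.
have p_gt0 : 0 < p by rewrite lt_def p_neq0 prob1_ge0.
have p_le1 : p <= 1 by apply: prob1_le1.
rewrite -dT in ld *; have n_gt0 := dt_depth_gt0 (leq_trans l_gt0 ld).
have K_bound := sum_norm_fourier_eval_le (K := moment_exponent n p).
apply: le_trans (K_bound _ _ _ _ _ _ _ ld) _.
- by move=> i; rewrite leq_moment_exponentS.
- exact: leq_exp2_moment_exponentS.
- exact: mul_exp2_moment_exponent0.
rewrite [leRHS]mulrAC ler_pM2r //.
have -> : 32 / ln 2 = 16 * (2 / ln 2) :> R by ring.
apply: sqrt_prod_scale_le; rewrite ?divr_gt0 ?ln2_gt0 // => i.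
by rewrite ler0n moment_exponent_le.
Qed.
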